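(* Let $N=(N_t)_{t\ge 0}$ be a non-homogeneous Poisson process, defined on a probability space with probability $\mathbb{P}$, with continuous intensity function $\lambda:[0,\infty)\to[0,\infty)$. Let $\tau^*>0$ and $m>0$ be such that $\lambda(t)=m$ for every $t\ge\tau^*$. For $\tau>\tau^*$ and $h\ge 0$ define $$\widehat m_\tau=\frac{N_\tau-N_{\tau^*}}{\tau-\tau^*},\qquad \widehat G_\tau(h)=1-\exp(-\widehat m_\tau h),\qquad G(h)=1-\exp(-mh).$$ Then, as $\tau\to\infty$, $$\sup_{h\ge 0}\bigl|\sqrt{\tau}\,\bigl(\widehat G_\tau(h)-G(h)\bigr)\bigr|\ \longrightarrow\ |Z|\quad\text{in distribution},$$ where $Z$ is a normal random variable with mean $0$ and variance $\exp(-2)/m$.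
   Context: A non-homogeneous Poisson process $N$ with intensity function $\lambda$ is a counting process with $N_0=0$, independent increments, right-continuous paths with left limits, and $N_t-N_s$ Poisson distributed with mean $\Lambda(t)-\Lambda(s)$ for $0\le s\le t$, where $\Lambda(t)=\int_0^t\lambda(u)\,du$ is the cumulative intensity function. *)

(* Defs.v *)
From HB Require Import structures.
From mathcomp Require Import all_boot all_order all_algebra.
From mathcomp Require Import all_classical all_reals all_analysis.

Set Implicit Arguments.
Unset Strict Implicit.
Unset Printing Implicit Defensive.

Import Order.TTheory GRing.Theory Num.Theory.
Import numFieldNormedType.Exports.

Local Open Scope classical_set_scope.
Local Open Scope ring_scope.

(* As the index type is finite and each [B i] may be the full set, the product
   rule for subfamilies is included. *)
Definition mutually_independent d d' (T : measurableType d)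
    (T' : measurableType d') (R : realType) (P : probability T R)
    (I : finType) (X : I -> T -> T') : Prop :=
  forall B : I -> set T', (forall i, measurable (B i)) ->
    P (\bigcap_i (X i @^-1` B i)) = (\prod_i P (X i @^-1` B i))%E.

(* Truncated subtraction is the true one here: the paths of a counting process
   are nondecreasing. *)
Definition increment (R : realType) (T : Type) (N : R -> T -> nat) (s t : R)
    (w : T) : nat := (N t w - N s w)%N.

Definition independent_increments d (T : measurableType d) (R : realType)
    (P : probability T R) (N : R -> T -> nat) : Prop :=
  forall (n : nat) (t : nat -> R), 0 <= t 0%N -> nondecreasing_seq t ->
    mutually_independent P (fun i : 'I_n => increment N (t i) (t i.+1)).

Definition cadlag (R : realType) (f : R -> R) : Prop :=
  (forall t : R, 0 <= t -> f u @[u --> t^'+] --> f t) /\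
  (forall t : R, 0 < t -> cvg (f u @[u --> t^'-])).

Definition cumulative_intensity (R : realType) (lambda : R -> R) (t : R) : R :=
  \int[lebesgue_measure]_(u in `[0, t]) lambda u.

(* Only the times [t >= 0] of [N : R -> _] are constrained. The second argument
   of the library's [poisson_prob] is unused, and [poisson_prob 0 _] is the
   Dirac mass at 0. *)
Record nonhomogeneous_poisson_process d (T : measurableType d) (R : realType)
    (P : probability T R) (N : R -> {RV P >-> nat}) (lambda : R -> R) : Prop := {
  nhpp_nondecreasing : forall w (s t : R), 0 <= s -> s <= t -> (N s w <= N t w)%N ;
  nhpp_start : forall w, N 0 w = 0%N ;
  nhpp_independent : independent_increments P N ;
  nhpp_cadlag : forall w, cadlag (fun t => (N t w)%:R : R) ;
  nhpp_poisson : forall s t : R, 0 <= s -> s <= t ->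
    pushforward P (increment N s t) =
    poisson_prob (cumulative_intensity lambda t
                  - cumulative_intensity lambda s) 0%N }.

Definition cvg_in_distribution (R : realType) (I : Type) (F : set_system I)
    d (T : measurableType d) (P : probability T R) (X : I -> {RV P >-> R})
    d' (T' : measurableType d') (P' : probability T' R) (Y : {RV P' >-> R}) :
    Prop :=
  forall x : R, {for x, continuous (cdf Y)} ->
    cdf (X i) x @[i --> F] --> cdf Y x.

Definition m_hat (R : realType) (T : Type) (N : R -> T -> nat)
    (tau_star tau : R) (w : T) : R :=
  ((N tau w)%:R - (N tau_star w)%:R) / (tau - tau_star).

Definition G (R : realType) (m h : R) : R := 1 - expR (- m * h).

Definition G_hat (R : realType) (T : Type) (N : R -> T -> nat)
    (tau_star tau : R) (w : T) (h : R) : R :=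
  1 - expR (- m_hat N tau_star tau w * h).

(* For [tau > tau_star] the set is bounded by [Num.sqrt tau], as [m] and
   [m_hat] are nonnegative: the real-valued [sup] is the true supremum. *)
Definition sup_error (R : realType) d (T : measurableType d)
    (P : probability T R) (N : R -> {RV P >-> nat})
    (m tau_star tau : R) (w : T) : R :=
  sup [set `| Num.sqrt tau * (G_hat N tau_star tau w h - G m h) |
      | h in `[0, +oo[ ].

Lemma measurable_sup_error (R : realType) d (T : measurableType d)
    (P : probability T R) (N : R -> {RV P >-> nat}) (m tau_star tau : R) :
  measurable_fun setT (sup_error N m tau_star tau).
Proof.
pose g (a b : nat) : R := sup [set `| Num.sqrt tau *
  (1 - expR (- ((a%:R - b%:R) / (tau - tau_star)) * h) - G m h) |
  | h in `[0, +oo[ ].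
move=> _ Y mY; rewrite setTI.
rewrite (_ : _ @^-1` Y = \bigcup_a \bigcup_b
    [set w | N tau w = a /\ N tau_star w = b /\ Y (g a b)]); last first.
  apply/seteqP; split => [w Yw|w [a _ [b _ /= [Na [Nb Yg]]]]].
    by exists (N tau w) => //; exists (N tau_star w).
  by rewrite /= /sup_error /G_hat /m_hat Na Nb.
apply: bigcupT_measurable => a; apply: bigcupT_measurable => b.
have [Yg|nYg] := pselect (Y (g a b)); last first.
  by rewrite (_ : [set _ | _] = set0)//; apply/seteqP; split => w // [_ []].
rewrite (_ : [set _ | _] = N tau @^-1` [set a] `&` N tau_star @^-1` [set b]).
  by apply: measurableI; exact: measurable_funPTI.
by apply/seteqP; split => w /=; [move=> [? []]|move=> []].
Qed.

HB.instance Definition _ (R : realType) d (T : measurableType d)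
    (P : probability T R) (N : R -> {RV P >-> nat}) (m tau_star tau : R) :=
  isMeasurableFun.Build d _ T R (sup_error N m tau_star tau)
    (measurable_sup_error N m tau_star tau).

Definition abs_rv (R : realType) d (T : measurableType d)
    (P : probability T R) (Z : {RV P >-> R}) (w : T) : R := `|Z w|.

Lemma measurable_abs_rv (R : realType) d (T : measurableType d)
    (P : probability T R) (Z : {RV P >-> R}) :
  measurable_fun setT (abs_rv Z).
Proof. by apply: measurableT_comp. Qed.

HB.instance Definition _ (R : realType) d (T : measurableType d)
    (P : probability T R) (Z : {RV P >-> R}) :=
  isMeasurableFun.Build d _ T R (abs_rv Z) (measurable_abs_rv Z).

(* Main.v *)
Require Import Defs.
From mathcomp Require Import all_boot all_order all_algebra.
From mathcomp Require Import all_classical all_reals all_analysis.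
From mathcomp Require Import measurable_realfun.
From mathcomp Require Import ring lra.
Import Order.TTheory GRing.Theory Num.Theory.
Import numFieldNormedType.Exports.
Local Open Scope classical_set_scope.
Local Open Scope ring_scope.

(** The statistic is a function of the increment of [N] over the window from
    [tau_star] to [tau], a Poisson variable [D] of mean
    [mu = m * (tau - tau_star)], because the intensity is [m] there. So the
    theorem has a probabilistic half, a central limit theorem for Poisson laws
    whose mean tends to infinity, and a deterministic half, the relation
    between the supremum and [D].

    Deterministic half. The map [h |-> h * exp (- m * h)] has maximum
    [exp (- 1) / m], reached at [h = 1 / m]; hence the supremum over [h] of the
    gap between the exponential distribution functions of rates [a] and [m] is
    about [exp (- 1) * |a / m - 1|] for [a] near [m]. Precisely, with
    [x = sqrt tau * (v * exp (- 1))], the event that the supremum is at most [x]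
    contains the event [m / (1 + v) <= m_hat <= m * (1 + v)]
    ([sup_error_le]) and is contained in the event
    [m * (1 - v) <= m_hat <= m / (1 - v)] ([sup_error_le_inv]). As [v] tends to
    0, both are events on [D] whose end points are
    [mu +- (x * e * sqrt m + o(1)) * sqrt mu]. The distribution function at [x]
    is thus squeezed between two quantities that tend to the standard normal
    mass of the interval of radius [x * e * sqrt m]
    ([cvg_cdf_sup_error]), which is the mass that the centred normal law of
    variance [exp (- 2) / m] gives to the interval from [- x] to [x]
    ([normal_prob_scale]).

    Probabilistic half ([poisson_clt]). The probability that a Poisson variable
    of mean [mu] is at most [k] is the tail, from [mu] on, of the Gamma density
    [z ^+ k * exp (- z) / k!]. After the substitution
    [z = k + sqrt k * y] this density is proportional to
    [(1 + y / sqrt k) ^+ k * exp (- sqrt k * y)], which tends pointwise to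
    [exp (- y ^+ 2 / 2)] and is dominated by an integrable function independent
    of [k] ([std_gamma_le_envelope]). Dominated convergence
    ([cvg_integral_std_gamma]) gives the limit of its tails, and, for the
    integral over all [z >= 0], the limit of the normalizing constants; the
    latter is Stirling's formula ([cvg_stirling_ratio]). The quotient of the two
    limits is the central limit theorem. *)

(** * The Poisson distribution function as a Gamma tail *)

Definition poisson_cdf {R : realType} (k : nat) (x : R) : R :=
  expR (- x) * \sum_(j < k.+1) x ^+ j / j`!%:R.

Lemma poisson_cdfS {R : realType} k (x : R) :
  poisson_cdf k.+1 x = poisson_cdf k x + expR (- x) * (x ^+ k.+1 / k.+1`!%:R).
Proof. by rewrite /poisson_cdf big_ord_recr mulrDr. Qed.

(** In the derivative of the partial exponential sum times [expR (- x)] all the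
    terms but the last cancel in pairs, leaving minus the density of the Gamma
    law of shape [k + 1]. *)
Lemma is_derive_poisson_cdf {R : realType} k (x : R) :
  is_derive x 1 (poisson_cdf k) (- (expR (- x) * (x ^+ k / k`!%:R))).
Proof.
elim: k => [|k IH].
  rewrite (_ : poisson_cdf 0 = fun y => expR (- y)); last first.
    by apply/funext => y; rewrite /poisson_cdf big_ord1 expr0 fact0 divr1 mulr1.
  by apply: is_derive_eq; rewrite expr0 fact0 divr1 mulr1 mulrN1.
rewrite (_ : poisson_cdf k.+1 = poisson_cdf k +
    (fun y => expR (- y) * (y ^+ k.+1 / k.+1`!%:R))); last first.
  by apply/funext => y; rewrite poisson_cdfS.
have dX : is_derive x 1 (fun y : R => y ^+ k.+1) (k.+1%:R * x ^+ k).
  have -> : (fun y : R => y ^+ k.+1) = id ^+ k.+1 by apply/funext => y; rewrite fctE.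
  by apply: is_derive_eq; rewrite -mulr_natl scaler1.
have dX' : is_derive x 1 (fun y : R => y ^+ k.+1 / k.+1`!%:R) (x ^+ k / k`!%:R).
  rewrite (_ : (fun _ => _) = (k.+1`!%:R)^-1 \*: (fun y : R => y ^+ k.+1)); last first.
    by apply/funext => y /=; rewrite mulrC.
  apply: is_derive_eq; rewrite /GRing.scale/= factS natrM; field.
  by rewrite -mulrS !pnatr_eq0 -lt0n fact_gt0.
apply: is_derive_eq; rewrite /GRing.scale/=.
ring.
Qed.

Lemma cvg_poisson_cdf_y {R : realType} k :
  poisson_cdf k x @[x --> +oo] --> (0 : R).
Proof.
have H j : expR (- x) * (x ^+ j / j`!%:R) @[x --> +oo] --> (0 : R).
  apply: (@squeeze_cvgr _ _ _ _ (fun=> 0) (fun x : R => j.+1%:R / x)); last 2 first.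
  - exact: cvg_cst.
  - rewrite -[X in _ --> X](mulr0 (j.+1%:R : R)); apply: cvgMl_tmp.
    rewrite gtr0_cvgV0; first exact: cvg_id.
    exact: nbhs_pinfty_gt.
  near=> x; have x0 : 0 < x by near: x; exact: nbhs_pinfty_gt.
  rewrite mulr_ge0 ?expR_ge0 ?divr_ge0 ?exprn_ge0 ?(ltW x0)//=.
  have := expR_ge1Dxn j (ltW x0).
  move=> h; rewrite expRN mulrC ler_pdivrMr ?expR_gt0//.
  (* The Taylor term of order [j + 1] of [expR] dominates [x ^+ j]. *)
  have -> : x ^+ j / j`!%:R = j.+1%:R / x * (x ^+ j.+1 / j.+1`!%:R).
    rewrite factS natrM exprS; field.
    by rewrite -mulrS !pnatr_eq0 (gt_eqF x0) -lt0n fact_gt0.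
  by rewrite ler_pM2l ?divr_gt0// (le_trans _ h)// lerDr.
elim: k => [|k IH].
  have := H 0%N; apply: cvg_trans; apply: near_eq_cvg; near=> x.
  by rewrite /poisson_cdf big_ord1.
rewrite -(addr0 (0:R)).
under eq_fun do rewrite poisson_cdfS.
exact: cvgD.
Unshelve. all: by end_near. Qed.

(** The Gamma density of shape [k + 1] in the variable [y] such that
    [z = k + sqrt k * y], scaled so that its value at [y = 0] is that of the
    standard normal density; its integral over
    [y >= - sqrt k] tends to 1 without being equal to 1. *)
Definition std_gamma {R : realType} (k : nat) (y : R) : R :=
  normal_peak 1 * ((1 + y / Num.sqrt k%:R) ^+ k * expR (- (Num.sqrt k%:R * y))).

(** The quotient of [k!] by Stirling's approximation
    [sqrt (2 * pi * k) * (k / e) ^+ k]; recall that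
    [normal_peak 1 = 1 / sqrt (2 * pi)]. It is also the integral
    of [std_gamma k] over [y >= - sqrt k], that is over [z >= 0]. *)
Definition stirling_ratio {R : realType} (k : nat) : R :=
  normal_peak 1 * (k`!%:R * expR k%:R / (k%:R ^+ k * Num.sqrt k%:R)).

Lemma continuous_std_gamma {R : realType} k : continuous (@std_gamma R k).
Proof.
move=> y; apply: cvgM; first exact: cvg_cst.
apply: cvgM.
  apply: (@cvg_comp _ _ _ (fun y : R => 1 + y / Num.sqrt k%:R) (fun z => z ^+ k)).
    by apply: cvgD; [exact: cvg_cst|apply: cvgMr_tmp; exact: cvg_id].
  exact: exprn_continuous.
apply: (cvg_comp _ expR); last exact: continuous_expR.
by apply: cvgN; apply: cvgMl_tmp; exact: cvg_id.
Qed.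

Lemma std_gamma_ge0 {R : realType} k (y : R) :
  (0 < k)%N -> - Num.sqrt k%:R <= y -> 0 <= std_gamma k y.
Proof.
move=> k0 ky; rewrite mulr_ge0 ?normal_peak_ge0// mulr_ge0 ?expR_ge0//.
have s0 : 0 < Num.sqrt (k%:R : R) by rewrite sqrtr_gt0 ltr0n.
by rewrite exprn_ge0// -lerBlDl sub0r ler_pdivlMr// mulN1r.
Qed.

(** By [is_derive_poisson_cdf] and the chain rule, minus
    [stirling_ratio k * poisson_cdf k (k + sqrt k * y)] is an antiderivative of
    [std_gamma k] which vanishes at infinity. *)
Lemma integral_std_gamma {R : realType} k (c : R) :
  (0 < k)%N -> - Num.sqrt k%:R <= c ->
  (\int[lebesgue_measure]_(y in `[c, +oo[) (std_gamma k y)%:E =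
   (stirling_ratio k * poisson_cdf k (k%:R + Num.sqrt k%:R * c))%:E)%E.
Proof.
move=> k0 kc; set s := Num.sqrt (k%:R : R).
have s0 : 0 < s by rewrite sqrtr_gt0 ltr0n.
have kss : k%:R = s ^+ 2 by rewrite sqr_sqrtr// ler0n.
pose F y := - (stirling_ratio k * poisson_cdf k (k%:R + s * y)).
have dF (y : R) : is_derive y 1 F (std_gamma k y).
  have dg : is_derive y 1 (fun y : R => k%:R + s * y) s.
    rewrite (_ : (fun _ => _) = cst k%:R + s \*: id)//.
    by apply: is_derive_eq; rewrite /GRing.scale/= add0r mulr1.
  have := @is_derive1_comp R (poisson_cdf k) _ y _ _
     (is_derive_poisson_cdf k (k%:R + s * y)) dg.
  move=> dc; have -> : F = - (stirling_ratio k \*: (poisson_cdf k \o (fun y : R => k%:R + s * y))).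
    by apply/funext.
  apply: is_derive_eq; rewrite /GRing.scale/= /stirling_ratio /std_gamma -/s.
  have -> : expR (- (k%:R + s * y)) = (expR k%:R)^-1 * expR (- (s * y)).
    by rewrite opprD expRD expRN.
  have -> : (k%:R + s * y) ^+ k = k%:R ^+ k * (1 + y / s) ^+ k.
    by rewrite -exprMn kss; congr (_ ^+ _); field; rewrite gt_eqF.
  field; rewrite (gt_eqF s0) (gt_eqF (expR_gt0 _)) expf_neq0 ?pnatr_eq0 -?lt0n ?k0 ?fact_gt0//.
have cF (y : R) : {for y, continuous F}.
  by apply/differentiable_continuous/derivable1_diffP; exact: ex_derive.
rewrite (@ge0_continuous_FTC2y R (std_gamma k) F c 0).
- by rewrite /F EFinN oppeK add0e.
- by move=> x cx; rewrite std_gamma_ge0// (le_trans kc).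
- by apply: continuous_subspaceT; exact: continuous_std_gamma.
- rewrite -oppr0; apply: cvgN; rewrite -[X in _ --> X](mulr0 (stirling_ratio k)).
  apply: cvgMl_tmp.
  apply: (@cvg_comp _ _ _ (fun y : R => k%:R + s * y) (poisson_cdf k) _ +oo); last first.
    exact: cvg_poisson_cdf_y.
  apply/cvgryPge => A; near=> x.
  rewrite -lerBlDl mulrC -ler_pdivrMr//; near: x; exact: nbhs_pinfty_ge.
- by move=> x _; exact: ex_derive.
- exact/cvg_at_right_filter/cF.
- by move=> x _; rewrite derive1E derive_val.
Unshelve. all: by end_near. Qed.

(** * Second order bounds for the logarithm *)

Lemma ndecr_gtN1 {R : realType} (f df : R -> R) :
  (forall x : R, -1 < x -> is_derive x 1 f (df x)) ->
  (forall x : R, -1 < x -> 0 <= df x) ->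
  forall a b, -1 < a -> a <= b -> f a <= f b.
Proof.
move=> fdf df0 a b a1 ab.
have [||c] := @MVT_segment R f df a b ab.
- by move=> x; rewrite in_itv/= => /andP[ax _]; apply: fdf; exact: lt_trans ax.
- apply: derivable_within_continuous => x; rewrite in_itv/= => /andP[ax _].
  by apply: (@ex_derive _ _ _ _ _ _ _ (fdf x _)); exact: lt_le_trans ax.
- rewrite in_itv/= => /andP[ac _] fE.
  by rewrite -subr_ge0 fE mulr_ge0 ?subr_ge0// df0// (lt_le_trans a1).
Qed.

(** This and [nincr_ln1p_sqr] are used with 0 as one of the two points: the
    functions vanish there, so their monotonicity compares [ln (1 + u) - u] with
    [- u ^+ 2 / 2] and with [- u ^+ 2 / (2 * (1 + u))], in opposite directions
    on the two sides of 0. *)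
Lemma ndecr_ln1p_sqr {R : realType} (a b : R) : -1 < a -> a <= b ->
  ln (1 + a) - a + a ^+ 2 / 2 <= ln (1 + b) - b + b ^+ 2 / 2.
Proof.
apply: (@ndecr_gtN1 R (fun x => ln (1 + x) - x + x ^+ 2 / 2)
  (fun x => x ^+ 2 / (1 + x))) => x x1.
- have x0 : 0 < 1 + x by rewrite -ltrBlDl sub0r.
  have h : is_derive (1 + x) 1 (@ln R) (1 + x)^-1 by exact: is_derive1_ln.
  have h1 : is_derive x 1 (fun x : R => 1 + x) 1.
    rewrite (_ : (fun _ => _) = cst 1 + id)//.
    by apply: is_derive_eq; rewrite add0r.
  have h2 := @is_derive1_comp R (@ln R) _ x _ _ h h1.
  have h3 : is_derive x 1 (fun x : R => x ^+ 2 / 2) x.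
    rewrite (_ : (fun _ => _) = 2^-1 \*: (id ^+ 2)); last first.
      by apply/funext => y; rewrite /= fctE mulrC.
    by apply: is_derive_eq; rewrite /GRing.scale/= expr1; field.
  rewrite (_ : (fun _ => _) = (@ln R \o (fun x => 1 + x)) - id + (fun x : R => x ^+ 2 / 2))//.
  by apply: is_derive_eq; field; rewrite gt_eqF.
- by rewrite divr_ge0 ?sqr_ge0// ltW// -ltrBlDl sub0r.
Qed.

(** The derivative is [- (x / (1 + x)) ^+ 2 / 2]. *)
Lemma nincr_ln1p_sqr {R : realType} (a b : R) : -1 < a -> a <= b ->
  ln (1 + b) - b + b ^+ 2 / (2 * (1 + b)) <=
  ln (1 + a) - a + a ^+ 2 / (2 * (1 + a)).
Proof.
move=> a1 ab; rewrite -lerN2.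
(* A rewriting of the function that is easier to differentiate. *)
pose f (x : R) := - (ln (1 + x) - x + (x - 1 + (1 + x)^-1) / 2).
have fE (x : R) : -1 < x -> - (ln (1 + x) - x + x ^+ 2 / (2 * (1 + x))) = f x.
  move=> x1; rewrite /f; congr (- (_ + _)); field.
  by rewrite gt_eqF// -ltrBlDl sub0r.
rewrite !fE ?(lt_le_trans a1)//.
apply: (@ndecr_gtN1 R f (fun x => (x / (1 + x)) ^+ 2 / 2)) => // x x1.
- have x0 : 0 < 1 + x by rewrite -ltrBlDl sub0r.
  have h : is_derive (1 + x) 1 (@ln R) (1 + x)^-1 by exact: is_derive1_ln.
  have h1 : is_derive x 1 (fun x : R => 1 + x) 1.
    rewrite (_ : (fun _ => _) = cst 1 + id)//.
    by apply: is_derive_eq; rewrite add0r.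
  have h2 := @is_derive1_comp R (@ln R) _ x _ _ h h1.
  have h4 : is_derive x 1 (fun x : R => (1 + x)^-1) (- (1 + x) ^- 2).
    have n0 : 1 + x != 0 by rewrite gt_eqF.
    apply: DeriveDef; first exact: derivableV.
    by rewrite deriveV// derive_val /GRing.scale/= mulr1.
  have h3 : is_derive x 1 (fun x : R => (x - 1 + (1 + x)^-1) / 2) ((1 - (1 + x) ^- 2) / 2).
    rewrite (_ : (fun _ => _) = 2^-1 \*: (id - cst 1 + (fun x : R => (1 + x)^-1))); last first.
      by apply/funext => y; rewrite /= mulrC.
    by apply: is_derive_eq; rewrite /GRing.scale/= subr0 mulrC.
  rewrite (_ : f = - ((@ln R \o (fun x => 1 + x)) - id
    + (fun x : R => (x - 1 + (1 + x)^-1) / 2)))//.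
  by apply: is_derive_eq; field; rewrite gt_eqF.
- by rewrite divr_ge0 ?sqr_ge0.
Qed.

(** * Convergence of the standardized Gamma densities *)

Lemma std_gammaE {R : realType} k (y : R) : (0 < k)%N -> - Num.sqrt k%:R < y ->
  let u := y / Num.sqrt k%:R in
  std_gamma k y = normal_peak 1 * expR (k%:R * (ln (1 + u) - u)).
Proof.
move=> k0 ky u; rewrite /std_gamma -/u.
have s0 : 0 < Num.sqrt (k%:R : R) by rewrite sqrtr_gt0 ltr0n.
have u1 : 0 < 1 + u by rewrite -ltrBlDl sub0r ltr_pdivlMr// mulN1r.
rewrite mulrBr expRD -{1}[X in _ * (X * _)]mulr1 expRM_natl lnK// mulr1.
congr (_ * (_ * expR (- _))).
by rewrite -{2}(@sqr_sqrtr _ (k%:R : R)) ?ler0n// /u; field; rewrite gt_eqF.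
Qed.

Lemma normal_pdf01E {R : realType} (y : R) :
  normal_pdf 0 1 y = normal_peak 1 * expR (- (y ^+ 2 / 2)).
Proof.
rewrite normal_pdfE ?oner_eq0// /normal_fun subr0 expr1n mulNr.
by rewrite mulr2n.
Qed.

(** The exponent of [std_gamma k] lies between the Gaussian exponent and a
    perturbation of it; this serves both for the pointwise limit and for the
    domination. *)
Lemma gamma_exponent_bounds {R : realType} k (y : R) : (0 < k)%N ->
  - Num.sqrt k%:R < y ->
  let u := y / Num.sqrt k%:R in
  let e := k%:R * (ln (1 + u) - u) in
  [/\ 0 < 1 + u,
     (y <= 0 -> - (y ^+ 2 / (2 * (1 + u))) <= e <= - (y ^+ 2 / 2)) &
     (0 <= y -> - (y ^+ 2 / 2) <= e <= - (y ^+ 2 / (2 * (1 + u)))) ].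
Proof.
move=> k0 ky u e.
have s0 : 0 < Num.sqrt (k%:R : R) by rewrite sqrtr_gt0 ltr0n.
have u1 : 0 < 1 + u by rewrite -ltrBlDl sub0r ltr_pdivlMr// mulN1r.
have N1u : -1 < u by rewrite -subr_gt0 opprK addrC.
have yE : y ^+ 2 = k%:R * u ^+ 2.
  by rewrite -(@sqr_sqrtr _ (k%:R : R)) ?ler0n// /u; field; rewrite gt_eqF.
have kR0 : 0 < k%:R :> R by rewrite ltr0n.
have e1 : (- (y ^+ 2 / 2) <= e) = (0 <= ln (1 + u) - u + u ^+ 2 / 2).
  by rewrite yE -subr_ge0 opprK -mulrA -mulrDr pmulr_rge0.
have e2 : (e <= - (y ^+ 2 / 2)) = (ln (1 + u) - u + u ^+ 2 / 2 <= 0).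
  by rewrite yE -subr_le0 opprK -mulrA -mulrDr pmulr_rle0.
have e3 : (- (y ^+ 2 / (2 * (1 + u))) <= e) =
    (0 <= ln (1 + u) - u + u ^+ 2 / (2 * (1 + u))).
  by rewrite yE -subr_ge0 opprK -mulrA -mulrDr pmulr_rge0.
have e4 : (e <= - (y ^+ 2 / (2 * (1 + u)))) =
    (ln (1 + u) - u + u ^+ 2 / (2 * (1 + u)) <= 0).
  by rewrite yE -subr_le0 opprK -mulrA -mulrDr pmulr_rle0.
have N10 : -1 < 0 :> R by rewrite oppr_lt0.
split => // y0; rewrite ?e1 ?e2 ?e3 ?e4.
- have u0 : u <= 0 by rewrite ler_pdivrMr// mul0r.
  have := ndecr_ln1p_sqr _ _ N1u u0; have := nincr_ln1p_sqr _ _ N1u u0.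
  by rewrite !(addr0, ln1, subr0, expr0n, mul0r) => -> ->.
- have u0 : 0 <= u by rewrite divr_ge0// ltW.
  have := ndecr_ln1p_sqr _ _ N10 u0; have := nincr_ln1p_sqr _ _ N10 u0.
  by rewrite !(addr0, ln1, subr0, expr0n, mul0r) => -> ->.
Qed.

(** The left tails of [std_gamma k] are Gaussian, but the right ones are only
    exponential, uniformly in [k]: for [y >= 0] the bound is
    [normal_peak 1 * expR ((1 - y) / 2)]. *)
Definition std_gamma_envelope {R : realType} (y : R) : R :=
  normal_pdf 0 1 y + normal_peak 1 * expR 2^-1 * 2 * exponential_pdf 2^-1 y.

Lemma std_gamma_le_envelope {R : realType} k (y : R) : (0 < k)%N ->
  - Num.sqrt k%:R <= y -> std_gamma k y <= std_gamma_envelope y.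
Proof.
move=> k0; rewrite le_eqVlt => /predU1P[<-|ky].
  rewrite /std_gamma mulNr divff ?subrr ?expr0n ?gtn_eqF//; last first.
    by rewrite gt_eqF// sqrtr_gt0 ltr0n.
  rewrite mul0r mulr0 addr_ge0 ?normal_pdf_ge0// !mulr_ge0 ?expR_ge0 ?normal_peak_ge0//.
  by rewrite exponential_pdf_ge0.
have [u1 hneg hpos] := gamma_exponent_bounds _ _ k0 ky.
rewrite std_gammaE//; have [y0|y0] := ltP y 0.
- rewrite /std_gamma_envelope lt0_exponential_pdf// mulr0 addr0 normal_pdf01E.
  rewrite ler_wpM2l ?normal_peak_ge0// ler_expR.
  by have /andP[] := hneg (ltW y0).
- rewrite /std_gamma_envelope exponential_pdfE//.
  rewrite (@le_trans _ _ (normal_peak 1 * expR (2^-1 - y / 2)))//.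
    rewrite ler_wpM2l ?normal_peak_ge0// ler_expR.
    have /andP[_ /le_trans] := hpos y0; apply.
    (* As [sqrt k >= 1], the exponent is at most [- y ^+ 2 / (2 * (1 + y))], which no
       longer depends on [k], and [y ^+ 2 / (1 + y) >= y - 1]. *)
    have s1 : 1 <= Num.sqrt (k%:R : R) by rewrite -{1}sqrtr1 ler_sqrt ?ltr0n// ler1n.
    have uy : y / Num.sqrt k%:R <= y by rewrite ler_pdivrMr ?(lt_le_trans ltr01)// ler_peMr.
    rewrite lerNl opprB (@le_trans _ _ (y ^+ 2 / (2 * (1 + y))))//.
      rewrite ler_pdivlMr; last by nra.
      by nra.
    by rewrite ler_wpM2l ?sqr_ge0// lef_pV2 ?posrE; nra.
  rewrite /exponential_pdf.
  rewrite ler_wpDl ?normal_pdf_ge0// expRD.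
  rewrite [leRHS](_ : _ = normal_peak 1 * (expR 2^-1 * expR (- (y / 2))))//.
  by rewrite mulNr (mulrC _ y); field.
Qed.

Lemma integrable_std_gamma_envelope {R : realType} :
  lebesgue_measure.-integrable [set: R] (EFin \o std_gamma_envelope).
Proof.
rewrite /std_gamma_envelope.
rewrite [X in _.-integrable _ X](_ : _ = (EFin \o normal_pdf 0 1) \+
  (fun y : R => ((normal_peak 1 * expR 2^-1 * 2)%:E * (exponential_pdf 2^-1 y)%:E)))%E//.
apply: integrableD => //; first exact: integrable_normal_pdf.
by apply: integrableZl => //; exact: integrable_exponential_pdf.
Qed.

Lemma cvgy_sqrt {R : realType} (T : Type) (F : set_system T) {FF : Filter F}
  (f : T -> R) : f x @[x --> F] --> +oo -> Num.sqrt (f x) @[x --> F] --> +oo.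
Proof.
move=> /cvgryPge foo; apply/cvgryPge => A; near=> x.
have [A0|A0] := leP A 0; first exact: le_trans (sqrtr_ge0 _).
rewrite -(ler_pXn2r (n := 2)) ?nnegrE ?sqrtr_ge0 ?(ltW A0)//.
have Af : A ^+ 2 <= f x by near: x; exact: foo.
by rewrite sqr_sqrtr// (le_trans _ Af)// sqr_ge0.
Unshelve. all: by end_near. Qed.

Lemma cvg_invy {R : realType} (T : Type) (F : set_system T) {FF : Filter F}
  (f : T -> R) : f x @[x --> F] --> +oo -> (f x)^-1 @[x --> F] --> (0 : R).
Proof.
by move=> foo; rewrite gtr0_cvgV0//; apply: cvgry_gt.
Qed.

Lemma cvg_std_gamma {R : realType} (k : nat^nat) (y : R) :
  (forall n, 0 < k n)%N -> (k n)%:R @[n --> \oo] --> (+oo : set_system R) ->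
  std_gamma (k n) y @[n --> \oo] --> normal_pdf 0 1 y.
Proof.
move=> k0 koo.
have soo : Num.sqrt (k n)%:R @[n --> \oo] --> (+oo : set_system R).
  exact: cvgy_sqrt.
have ky : \forall n \near \oo, - Num.sqrt (k n)%:R < y.
  near=> n; rewrite ltrNl; near: n; exact: (cvgry_gt soo).
have cu : - (y ^+ 2 / (2 * (1 + y / Num.sqrt (k n)%:R))) @[n --> \oo] --> - (y ^+ 2 / 2).
  apply: cvgN; apply: cvgMl_tmp; apply: cvgV; first by rewrite pnatr_eq0.
  rewrite -[X in _ --> X]mulr1; apply: cvgMl_tmp.
  rewrite -[X in _ --> X]addr0; apply: cvgD; first exact: cvg_cst.
  by rewrite -[X in _ --> X](mulr0 y); apply: cvgMl_tmp; exact: cvg_invy.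
rewrite normal_pdf01E.
have : normal_peak 1 * expR ((k n)%:R * (ln (1 + y / Num.sqrt (k n)%:R) - y / Num.sqrt (k n)%:R))
    @[n --> \oo] --> normal_peak 1 * expR (- (y ^+ 2 / 2)).
  apply: cvgMl_tmp.
  apply: (cvg_comp _ expR); last exact: continuous_expR.
  have [y0|/ltW y0] := leP y 0.
  - apply: squeeze_cvgr cu (cvg_cst _); near=> n.
    have kyn : - Num.sqrt (k n)%:R < y by near: n.
    by have [_ /(_ y0)] := gamma_exponent_bounds _ _ (k0 n) kyn.
  - apply: squeeze_cvgr (cvg_cst _) cu; near=> n.
    have kyn : - Num.sqrt (k n)%:R < y by near: n.
    by have [_ _ /(_ y0)] := gamma_exponent_bounds _ _ (k0 n) kyn.
apply: cvg_trans; apply: near_eq_cvg; near=> n.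
by rewrite std_gammaE//; near: n.
Unshelve. all: by end_near. Qed.

(** Dominated convergence with a moving end point [c n]. The half-lines from
    [c n] on are only asked to tend to [D] off one point [a], so that this covers
    both [c n] tending to [a] and [c n] tending to minus infinity. *)
Lemma cvg_integral_std_gamma {R : realType} (k : nat^nat) (c : R^nat)
    (D : set R) (a : R) :
  (forall n, 0 < k n)%N -> (k n)%:R @[n --> \oo] --> (+oo : set_system R) ->
  (forall n, - Num.sqrt (k n)%:R <= c n) -> measurable D ->
  (forall y, y != a -> \forall n \near \oo, (c n <= y) = (y \in D)) ->
  (\int[lebesgue_measure]_(y in `[c n, +oo[) (std_gamma (k n) y)%:E)%E @[n --> \oo] -->
  normal_prob 0 1 D.
Proof.
move=> k0 koo kc mD cD.
under eq_fun do rewrite integral_mkcond restrict_EFin.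
rewrite /normal_prob integral_mkcond restrict_EFin.
pose f_ n := EFin \o (std_gamma (k n) \_ `[c n, +oo[).
pose f : R -> \bar R := EFin \o (normal_pdf 0 1 \_ D).
have [|||||_ _ //] := @dominated_convergence _ _ R lebesgue_measure setT
  measurableT f_ f (EFin \o std_gamma_envelope).
- move=> n; apply/measurable_EFinP; apply/(measurable_restrictT _ _).1 => //.
  apply: measurable_funTS.
  by apply: continuous_measurable_fun; exact: continuous_std_gamma.
- apply/measurable_EFinP; apply/(measurable_restrictT _ _).1 => //.
  by apply: measurable_funTS; exact: measurable_normal_pdf.
- exists [set a]; split => //; first exact: lebesgue_measure_set1.
  move=> y /= h; apply/eqP/negPn/negP => ya; apply: h => _.
  have := cD y ya; rewrite /f_ /f /= !patchE; have [yD|yD] := boolP (y \in D) => cDy.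
    apply: (@cvg_trans _ ((std_gamma (k n) y)%:E @[n --> \oo])); last first.
      by apply: cvg_EFin; [near=> n|exact: cvg_std_gamma].
    apply: near_eq_cvg; near=> n.
    have cy : (c n <= y) = true by near: n; exact: cDy.
    by rewrite /= patchE mem_set//= in_itv/= cy.
  apply: (@cvg_trans _ ((fun=> 0%E) n @[n --> \oo])); last exact: cvg_cst.
  apply: near_eq_cvg; near=> n.
  have cy : (c n <= y) = false by near: n; exact: cDy.
  by rewrite /= patchE memNset//= in_itv/= cy.
- exact: integrable_std_gamma_envelope.
- apply: aeW => y n _; rewrite /f_ /= patchE; case: ifPn => [|_].
    rewrite inE /= in_itv/= andbT => cy.
    by rewrite ger0_norm ?lee_fin ?std_gamma_ge0 ?std_gamma_le_envelope// (le_trans (kc n))//.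
  rewrite normr0 lee_fin addr_ge0 ?normal_pdf_ge0//.
  by rewrite !mulr_ge0 ?expR_ge0 ?normal_peak_ge0 ?exponential_pdf_ge0.
Unshelve. all: by end_near. Qed.

(** * The central limit theorem for Poisson laws *)

Lemma poisson_prob_le {R : realType} (mu : R) k : 0 < mu ->
  poisson_prob mu 0 [set j | (j <= k)%N] = (poisson_cdf k mu)%:E.
Proof.
move=> mu0; rewrite /poisson_prob mu0.
rewrite (_ : [set _ | _] = `I_k.+1)//.
rewrite esum_fset//; last by move=> i _; rewrite lee_fin poisson_pmf_ge0.
rewrite -fsbig_ord sumEFin /poisson_cdf mulr_sumr; congr EFin.
by apply: eq_bigr => i _; rewrite /poisson_pmf mu0 mulrC.
Qed.

Lemma poisson_cdf0 {R : realType} k : poisson_cdf k (0 : R) = 1.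
Proof.
rewrite /poisson_cdf oppr0 expR0 mul1r big_ord_recl expr0 fact0 divr1.
by rewrite big1 ?addr0// => i _; rewrite expr0n mul0r.
Qed.

Lemma normal_prob01_Ny {R : realType} (c : R) :
  normal_prob 0 1 `]-oo, c] = normal_prob 0 1 `[- c, +oo[.
Proof.
rewrite /normal_prob -{1}(opprK c) ge0_integration_by_substitutionNy.
- by apply: eq_integral => y _; rewrite /= !normal_pdf01E sqrrN.
- by apply: continuous_subspaceT; apply: continuous_normal_pdf; exact: oner_neq0.
- by move=> y _; exact: normal_pdf_ge0.
Qed.

(** Stirling's formula: [stirling_ratio k] is the integral of [std_gamma k] from
    [- sqrt k], that is from [z = 0], where [poisson_cdf k] is 1. *)
Lemma cvg_stirling_ratio {R : realType} (k : nat^nat) :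
  (forall n, 0 < k n)%N -> (k n)%:R @[n --> \oo] --> (+oo : set_system R) ->
  @stirling_ratio R (k n) @[n --> \oo] --> (1 : R).
Proof.
move=> k0 koo.
have soo : Num.sqrt (k n)%:R @[n --> \oo] --> (+oo : set_system R).
  exact: cvgy_sqrt.
have h : (\int[lebesgue_measure]_(y in `[(- Num.sqrt (k n)%:R)%R, +oo[)
    (std_gamma (k n) y)%:E)%E @[n --> \oo] --> @normal_prob R 0 1 setT.
  apply: (@cvg_integral_std_gamma R k (fun n => - Num.sqrt (k n)%:R) setT 0) => //.
  move=> y _; near=> n; rewrite in_setT lerNl; near: n => /=.
  by move/cvgryPge : soo; apply.
have -> : 1 = fine (normal_prob 0 1 [set: R]) by rewrite probability_setT.
rewrite -[normal_prob _ _ _]fineK ?fin_num_measure// in h.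
apply: cvg_trans (fine_cvg h); apply: near_eq_cvg; near=> n => /=.
by rewrite integral_std_gamma// mulrN -expr2 sqr_sqrtr ?ler0n// subrr poisson_cdf0 mulr1.
Unshelve. all: by end_near. Qed.

(** With [k] the integer part of [a n], the probability is
    [poisson_cdf k (mu n)], the quotient of the tail of [std_gamma k] from
    [(mu n - k) / sqrt k] by its mass from [- sqrt k] on. The mean [mu n] and the shape [k]
    are equivalent and [k] differs from [a n] by less than 1, so this end point
    tends to [- c]; the symmetry of the normal law turns the tail into a
    distribution function. *)
Lemma poisson_clt {R : realType} (mu a : R^nat) (c : R) :
  mu n @[n --> \oo] --> +oo ->
  (a n - mu n) / Num.sqrt (mu n) @[n --> \oo] --> c ->
  poisson_prob (mu n) 0 [set j | j%:R <= a n] @[n --> \oo] -->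
  normal_prob 0 1 `]-oo, c].
Proof.
move=> muoo zc.
(* The maxima in [k] and [c'] are inactive for large [n]; they make the bounds
   [0 < k n] and [- sqrt (k n) <= c' n] hold for all [n]. *)
pose k n := maxn 1 (Num.truncn (a n)).
have k0 n : (0 < k n)%N by rewrite leq_max.
pose c' n := Num.max (- Num.sqrt (k n)%:R) ((mu n - (k n)%:R) / Num.sqrt (k n)%:R).
pose r n := Num.sqrt (mu n).
have roo : r n @[n --> \oo] --> (+oo : set_system R) by exact: cvgy_sqrt.
have rV0 : (r n)^-1 @[n --> \oo] --> (0 : R) by exact: cvg_invy.
have r1 : \forall n \near \oo, 1 <= r n by move/cvgryPge : roo; apply.
have mur : \forall n \near \oo, mu n = r n ^+ 2.
  near=> n; rewrite sqr_sqrtr//; near: n.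
  by move/cvgryPge : muoo; apply.
pose z n := (a n - mu n) / r n.
have az : \forall n \near \oo, a n = r n * (r n + z n).
  near=> n; rewrite /z mulrDr mulrCA divff ?mulr1.
    by rewrite -expr2 -(near mur n)// addrC subrK.
  by rewrite gt_eqF// (lt_le_trans ltr01)//; near: n.
have zge : \forall n \near \oo, c - 1 < z n.
  by apply: (cvgr_gt _ zc); rewrite ltrBlDr ltrDl.
have ra : \forall n \near \oo, r n <= a n.
  near=> n; rewrite (near az n)//.
  have rc : 2 - c <= r n by near: n; move/cvgryPge : roo; apply.
  have r1n : 1 <= r n by near: n.
  have zn : c - 1 < z n by near: n.
  by nra.
have kb : \forall n \near \oo, (k n)%:R <= a n < (k n)%:R + 1.
  near=> n; have r1n : 1 <= r n by near: n.
  have ran : r n <= a n by near: n.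
  have a1 : 1 <= a n by exact: le_trans ran.
  have a0 : 0 <= a n by exact: le_trans a1.
  have kE : k n = Num.truncn (a n).
    by apply/maxn_idPr; rewrite truncn_ge_nat.
  by rewrite kE natr1; exact: truncn_itv.
have koo : (k n)%:R @[n --> \oo] --> (+oo : set_system R).
  apply/cvgryPge => A; near=> n.
  have : A + 1 <= r n by near: n; move/cvgryPge : roo; apply.
  have : r n <= a n by near: n.
  have /andP[_] : (k n)%:R <= a n < (k n)%:R + 1 by near: n.
  by lra.
(* The rounding error, in units of the standard deviation. *)
pose e n := (a n - (k n)%:R) / r n.
have e0 : e n @[n --> \oo] --> (0 : R).
  apply: squeeze_cvgr (cvg_cst 0) rV0; near=> n.
  have r1n : 1 <= r n by near: n.
  have r0n : 0 < r n by exact: lt_le_trans r1n.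
  have /andP[ka ak] : (k n)%:R <= a n < (k n)%:R + 1 by near: n.
  rewrite /e divr_ge0 ?subr_ge0 ?(ltW r0n)//=.
  by rewrite ler_piMl ?invr_ge0 ?(ltW r0n)// lerBlDl addrC ltW// addrC.
(* The quotient [k n / mu n]. *)
pose t n := 1 + (z n - e n) / r n.
have t1 : Num.sqrt (t n) @[n --> \oo] --> (1 : R).
  have tt : t n @[n --> \oo] --> (1 : R).
    rewrite -[X in _ --> X]addr0; apply: cvgD; first exact: cvg_cst.
    by rewrite -[X in _ --> X](mulr0 (c - 0)); apply: cvgM => //; exact: cvgB.
  by rewrite -sqrtr1; apply: (cvg_comp _ Num.sqrt tt); exact: sqrt_continuous.
have ksqrt : \forall n \near \oo, Num.sqrt (k n)%:R = r n * Num.sqrt (t n).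
  near=> n.
  have r1n : 1 <= r n by near: n.
  have r0n : 0 < r n by exact: lt_le_trans r1n.
  have tE : t n = 1 + ((a n - mu n) / r n - (a n - (k n)%:R) / r n) / r n by [].
  have -> : (k n)%:R = r n ^+ 2 * t n.
    have mE : mu n = r n ^+ 2 by near: n.
    by rewrite tE mE; field; rewrite gt_eqF.
  by rewrite sqrtrM ?sqr_ge0// sqrtr_sqr gtr0_norm.
have cE : \forall n \near \oo, c' n = (mu n - (k n)%:R) / Num.sqrt (k n)%:R.
  near=> n; apply/max_idPr.
  have kR0 : 0 < (k n)%:R :> R by rewrite ltr0n.
  have mu0 : 0 <= mu n by near: n; move/cvgryPge : muoo; apply.
  rewrite ler_pdivlMr ?sqrtr_gt0// mulNr -expr2 sqr_sqrtr ?ler0n//.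
  by rewrite lerBrDr addNr.
have cc : c' n @[n --> \oo] --> - c.
  have : (e n - z n) / Num.sqrt (t n) @[n --> \oo] --> - c.
    rewrite -[X in _ --> X]divr1 -(sub0r c); apply: cvgM; first exact: cvgB.
    by apply: cvgV => //; exact: oner_neq0.
  apply: cvg_trans; apply: near_eq_cvg; near=> n.
  have r1n : 1 <= r n by near: n.
  have r0n : 0 < r n by exact: lt_le_trans r1n.
  rewrite (near cE n)// (near ksqrt n)// invfM mulrA; congr (_ / _).
  by rewrite /e /z -mulrBl; congr (_ / _); ring.
have kc n : - Num.sqrt (k n)%:R <= c' n by rewrite le_max lexx.
have h : (\int[lebesgue_measure]_(y in `[c' n, +oo[) (std_gamma (k n) y)%:E)%E @[n --> \oo] -->
    @normal_prob R 0 1 `[- c, +oo[.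
  apply: (@cvg_integral_std_gamma R k c' _ (- c)) => // y yc.
  have [cy|yc'] := leP (- c) y.
    have cy' : - c < y by rewrite lt_neqAle eq_sym yc.
    near=> n; rewrite mem_set/=; last by rewrite in_itv/= cy.
    by apply/ltW; near: n; exact: (cvgr_lt _ cc).
  near=> n; rewrite memNset/=; last by apply/negP; rewrite in_itv/= andbT -ltNge.
  by apply/negbTE; rewrite -ltNge; near: n; exact: (cvgr_gt _ cc).
have s1 := cvg_stirling_ratio k k0 koo.
rewrite normal_prob01_Ny.
rewrite -[normal_prob _ _ _]fineK ?fin_num_measure// in h *.
have {}h : fine (\int[lebesgue_measure]_(y in `[c' n, +oo[) (std_gamma (k n) y)%:E)%E
    @[n --> \oo] --> fine (normal_prob 0 1 `[- c, +oo[).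
  exact: fine_cvg.
have hq : poisson_cdf (k n) (mu n) @[n --> \oo] --> fine (normal_prob 0 1 `[- c, +oo[).
  rewrite -[X in _ --> X]divr1.
  (* The normalizing constant cancels in the quotient by [stirling_ratio (k n)]. *)
  apply: cvg_trans (cvgM h (cvgV (oner_neq0 _) s1)); apply: near_eq_cvg; near=> n.
  have sn : 0 < @stirling_ratio R (k n) by near: n; apply: (cvgr_gt _ s1).
  have kR0 : 0 < (k n)%:R :> R by rewrite ltr0n.
  rewrite /= integral_std_gamma//= (near cE n)// mulrC mulKf ?gt_eqF//.
  by congr poisson_cdf; rewrite mulrC divfK ?gt_eqF ?sqrtr_gt0// addrC subrK.
have hE : (poisson_cdf (k n) (mu n))%:E @[n --> \oo] -->
    (fine (normal_prob 0 1 `[- c, +oo[))%:E.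
  by apply: cvg_EFin hq; exact: nearW.
apply: cvg_trans hE; apply: near_eq_cvg; near=> n => /=.
have mu0 : 0 < mu n by near: n; move/cvgryPgt : muoo; apply.
rewrite -poisson_prob_le//; congr (poisson_prob _ _ _); apply/seteqP.
have /andP[ka ak] : (k n)%:R <= a n < (k n)%:R + 1 by near: n.
split => j /=.
- by move=> jk; rewrite (le_trans _ ka)// ler_nat.
- by move=> ja; rewrite -ltnS -(ltr_nat R) -natr1 (le_lt_trans ja).
Unshelve. all: by end_near. Qed.

(** * The supremum of the gap between two exponential laws *)

Lemma mul_expRN_le {R : realType} (x : R) : x * expR (- x) <= expR (-1).
Proof.
rewrite -ler_pdivlMr ?expR_gt0// -expRN opprK -expRD.
by have := expR_ge1Dx (-1 + x); rewrite addrA subrr add0r.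
Qed.

(** Factor out the larger exponential: the gap is
    [exp (- b * h) * (1 - exp (- (a - b) * h))], at most
    [exp (- b * h) * ((a - b) * h)], and [z * exp (- z)] is at most
    [exp (- 1)]. *)
Lemma expRN_gap_le {R : realType} (a b h : R) : 0 < b -> b <= a -> 0 <= h ->
  `|expR (- b * h) - expR (- a * h)| <= (a - b) / b * expR (-1).
Proof.
move=> b0 ba h0.
have -> : - a * h = - b * h + - ((a - b) * h) by ring.
rewrite expRD -{1}[expR (- b * h)]mulr1 -mulrBr normrM ger0_norm ?expR_ge0//.
have abh : 0 <= (a - b) * h by rewrite mulr_ge0// subr_ge0.
rewrite ger0_norm ?subr_ge0 -?expR0 ?ler_expR ?oppr_le0// expR0.
rewrite (@le_trans _ _ (expR (- b * h) * ((a - b) * h)))//.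
  rewrite ler_wpM2l ?expR_ge0// lerBlDr -lerBlDl.
  by have := expR_ge1Dx (- ((a - b) * h)).
have -> : expR (- b * h) * ((a - b) * h) = (a - b) / b * ((b * h) * expR (- (b * h))).
  by rewrite mulNr; field; rewrite gt_eqF.
by rewrite ler_wpM2l ?mul_expRN_le// divr_ge0 ?subr_ge0// ltW.
Qed.

(** [expRN_gap_le] divides by the smaller of the two rates, which is [m] or [a]
    according to the sign of [a - m]; this explains the asymmetric interval. *)
Lemma exp_cdf_gap_le {R : realType} (a m v h : R) : 0 < m -> 0 <= v ->
  m / (1 + v) <= a <= m * (1 + v) -> 0 <= h ->
  `|(1 - expR (- a * h)) - (1 - expR (- m * h))| <= v * expR (-1).
Proof.
move=> m0 v0 /andP[ma am] h0.
have v1 : 0 < 1 + v by rewrite ltr_pwDl.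
have a0 : 0 < a by rewrite (lt_le_trans _ ma)// divr_gt0.
rewrite (_ : _ - _ = expR (- m * h) - expR (- a * h)); last by ring.
have [ge_am|/ltW le_am] := leP m a.
  rewrite (le_trans (expRN_gap_le _ _ _ m0 ge_am h0))// ler_wpM2r ?expR_ge0//.
  by rewrite ler_pdivrMr//; lra.
rewrite distrC (le_trans (expRN_gap_le _ _ _ a0 le_am h0))// ler_wpM2r ?expR_ge0//.
by move: ma; rewrite !ler_pdivrMr//; lra.
Qed.

(** The time [1 / m] is where the gap is largest to first order. With
    [u = a / m - 1] the gap there is [exp (- 1) * |1 - exp (- u)|], and both bounds
    on [u] come from [1 + z <= exp z]. *)
Lemma exp_cdf_gap_inv {R : realType} (a m v : R) : 0 < m -> 0 <= a -> v < 1 ->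
  `|(1 - expR (- a * m^-1)) - (1 - expR (- m * m^-1))| <= v * expR (-1) ->
  m * (1 - v) <= a <= m / (1 - v).
Proof.
move=> m0 a0 v1.
have v10 : 0 < 1 - v by rewrite subr_gt0.
set u := a / m - 1.
have aE : a = m * (1 + u) by rewrite /u; field; rewrite gt_eqF.
rewrite (_ : _ - _ = expR (-1) * (1 - expR (- u))); last first.
  rewrite mulrBr mulr1 -expRD !mulNr divff ?gt_eqF//.
  have -> : -1 - u = - (a / m) by rewrite /u; ring.
  by ring.
rewrite normrM ger0_norm ?expR_ge0// mulrC ler_pM2r ?expR_gt0// ler_norml => /andP[lo hi].
have u1 : 0 <= 1 + u by rewrite /u addrC subrK divr_ge0// ltW.
rewrite aE ler_pM2l// ler_pM2l//; apply/andP; split.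
- by have := expR_ge1Dx (- u); lra.
- rewrite -[leRHS]div1r ler_pdivlMr//.
  have e1 : expR (- u) * (1 + u) <= 1.
    by rewrite expRN mulrC ler_pdivrMr ?expR_gt0// mul1r expR_ge1Dx.
  by nra.
Qed.

Section sup_error_bounds.
Context {R : realType} {d : measure_display} {T : measurableType d} {P : probability T R}.
Variables (N : R -> {RV P >-> nat}) (m tau_star tau : R) (w : T).
Hypotheses (m0 : 0 < m) (tau_star0 : 0 < tau_star) (tau_star_lt : tau_star < tau).
Hypothesis Nle : (N tau_star w <= N tau w)%N.

Let errors : set R := [set `|Num.sqrt tau * (G_hat N tau_star tau w h - G m h)|
  | h in `[0, +oo[].

Lemma m_hat_ge0 : 0 <= m_hat N tau_star tau w.
Proof. by rewrite /m_hat divr_ge0 ?subr_ge0 ?ler_nat// ltW. Qed.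

Lemma errors_has_sup : has_sup errors.
Proof.
split; first by exists `|Num.sqrt tau * (G_hat N tau_star tau w 0 - G m 0)|, 0 => //=;
  rewrite in_itv/= lexx.
exists (Num.sqrt tau) => _ [h /= + <-]; rewrite in_itv/= andbT => h0.
rewrite normrM ger0_norm ?sqrtr_ge0// ler_piMr ?sqrtr_ge0//.
have H (a : R) : 0 <= a -> 0 < expR (- a * h) <= 1.
  by move=> a0; rewrite expR_gt0/= -expR0 ler_expR mulNr oppr_le0 mulr_ge0.
have /andP[A1 A2] := H _ m_hat_ge0; have /andP[B1 B2] := H _ (ltW m0).
rewrite /G_hat /G ler_norml; lra.
Qed.

Lemma sup_error_ge0 : 0 <= sup_error N m tau_star tau w.
Proof.
have [_ sE] := errors_has_sup.
apply: (@le_trans _ _ `|Num.sqrt tau * (G_hat N tau_star tau w 0 - G m 0)|) => //.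
by apply: (ub_le_sup sE); exists 0 => //=; rewrite in_itv/= lexx.
Qed.

Lemma sup_error_le v : 0 <= v ->
  m / (1 + v) <= m_hat N tau_star tau w <= m * (1 + v) ->
  sup_error N m tau_star tau w <= Num.sqrt tau * (v * expR (-1)).
Proof.
move=> v0 mv; apply: ge_sup; first exact: errors_has_sup.1.
move=> _ [h /= + <-]; rewrite in_itv/= andbT => h0.
rewrite normrM ger0_norm ?sqrtr_ge0// ler_wpM2l ?sqrtr_ge0//.
exact: exp_cdf_gap_le.
Qed.

Lemma sup_error_le_inv v : v < 1 ->
  sup_error N m tau_star tau w <= Num.sqrt tau * (v * expR (-1)) ->
  m * (1 - v) <= m_hat N tau_star tau w <= m / (1 - v).
Proof.
move=> v1 sv; apply: exp_cdf_gap_inv => //; first exact: m_hat_ge0.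
have t0 : 0 < Num.sqrt tau by rewrite sqrtr_gt0 (lt_trans tau_star0).
rewrite -(ler_pM2l t0) (le_trans _ sv)// -{1}(ger0_norm (ltW t0)) -normrM.
apply: (ub_le_sup errors_has_sup.2); exists m^-1 => //=.
by rewrite in_itv/= invr_ge0 ltW.
Qed.

End sup_error_bounds.

(** * Constant intensity and scaling of the normal law *)

Lemma cumulative_intensity_cst {R : realType} (lambda : R -> R) (m s t : R) :
  {within `[0, +oo[, continuous lambda} -> (forall u, s <= u -> lambda u = m) ->
  0 <= s -> s <= t ->
  cumulative_intensity lambda t - cumulative_intensity lambda s = m * (t - s).
Proof.
move=> cl lm s0 st; rewrite /cumulative_intensity.
have il : lebesgue_measure.-integrable `[0, t] (EFin \o lambda).
  apply: continuous_compact_integrable; first exact: segment_compact.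
  by apply: continuous_subspaceW cl => x /=; rewrite !in_itv/= => /andP[->].
rewrite Rintegral_itvB//.
rewrite (@eq_Rintegral _ _ _ _ _ (cst m)); last first.
  by move=> u; rewrite inE/= in_itv/= => /andP[/ltW su _]; exact: lm.
rewrite Rintegral_cst//= lebesgue_measure_itv/= lte_fin.
by case: ltgtP st => //= -> _; rewrite subrr.
Qed.

Lemma normal_prob_scale {R : realType} (sigma x : R) : 0 < sigma -> 0 <= x ->
  normal_prob 0 sigma `[- x, x] = normal_prob 0 1 `[- (x / sigma), x / sigma].
Proof.
move=> s0 x0; rewrite /normal_prob.
pose F (y : R) := y / sigma.
have dF (y : R) : is_derive y 1 F sigma^-1.
  rewrite (_ : F = sigma^-1 \*: id); last first.
    by apply/funext => z; rewrite /F /= mulrC.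
  by apply: is_derive_eq; rewrite /GRing.scale/= mulr1.
have F'E : derive1 F = cst sigma^-1.
  by apply/funext => y; rewrite derive1E derive_val.
have cF (y : R) : {for y, continuous F}.
  by apply/differentiable_continuous/derivable1_diffP; exact: ex_derive.
have FN : - (x / sigma) = F (- x) by rewrite /F mulNr.
rewrite FN -[x / sigma]/(F x) (@integration_by_substitution_increasing _ F).
- apply: eq_integral => y _; congr EFin.
  rewrite F'E -[RHS]/(normal_pdf 0 1 (F y) * sigma^-1).
  rewrite normal_pdf01E normal_pdfE ?gt_eqF// /normal_peak /normal_fun /F subr0.
  rewrite expr1n mul1r -mulrnAr sqrtrM ?sqr_ge0// sqrtr_sqr gtr0_norm//.
  rewrite invfM [sigma^-1 * _]mulrC mulrAC; congr (_ * expR _ * _).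
  rewrite expr_div_n mulNr mulr2n; field.
  by rewrite !gt_eqF ?addr_gt0 ?exprn_gt0.
- by rewrite ge0_cp.
- by move=> y z _ _ yz; rewrite /F ltr_pM2r ?invr_gt0.
- by rewrite F'E => ? _; exact: cst_continuous.
- by rewrite F'E; exact: is_cvg_cst.
- by rewrite F'E; exact: is_cvg_cst.
- split.
  + by move=> y _; exact: ex_derive.
  + exact/cvg_at_right_filter/cF.
  + exact/cvg_at_left_filter/cF.
- by apply: continuous_subspaceT; apply: continuous_normal_pdf; exact: oner_neq0.
Qed.

(** * The distribution of the supremum *)

Lemma probability_setD d (T : measurableType d) (R : realType)
    (Q : probability T R) (A B : set T) : measurable A -> measurable B ->
  B `<=` A -> Q (A `\` B) = (Q A - Q B)%E.
Proof.
move=> mA mB BA; rewrite measureD//; first by rewrite setIidr.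
by rewrite -ge0_fin_numE// fin_num_measure.
Qed.

Lemma cvg_poisson_itv {R : realType} (mu a b : R^nat) (ca cb : R) :
  mu n @[n --> \oo] --> +oo ->
  (a n - mu n) / Num.sqrt (mu n) @[n --> \oo] --> ca ->
  (b n - mu n) / Num.sqrt (mu n) @[n --> \oo] --> cb ->
  (\forall n \near \oo, b n <= a n) -> cb <= ca ->
  poisson_prob (mu n) 0 [set j | b n < j%:R <= a n] @[n --> \oo] -->
  normal_prob 0 1 `]cb, ca].
Proof.
move=> muoo hca hcb ba cab.
have -> : normal_prob 0 1 `]cb, ca] =
    (normal_prob 0 1 `]-oo, ca] - normal_prob 0 1 `]-oo, cb])%E.
  rewrite -probability_setD//; last by apply: subset_itvl; rewrite bnd_simp.
  congr (normal_prob _ _ _); apply/seteqP; split => y /=; rewrite !in_itv/=.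
    by move=> /andP[cy ->]; split => //; apply/negP; rewrite -ltNge.
  by move=> [-> /negP]; rewrite -ltNge => ->.
have hdef : (normal_prob 0 1 `]-oo, ca] +? - @normal_prob R 0 1 `]-oo, cb])%E.
  by rewrite fin_num_adde_defl// fin_numN fin_num_measure.
have h : (poisson_prob (mu n) 0 [set j | (j%:R <= a n)%R] -
    poisson_prob (mu n) 0 [set j | (j%:R <= b n)%R])%E @[n --> \oo] -->
    (normal_prob 0 1 `]-oo, ca] - @normal_prob R 0 1 `]-oo, cb])%E.
  by apply: cvgeB hdef _ _; exact: poisson_clt.
apply: cvg_trans h; apply: near_eq_cvg; near=> n => /=.
have ban : b n <= a n by near: n.
rewrite -probability_setD//; last by move=> j /= /le_trans; apply.
congr (poisson_prob _ _ _); apply/seteqP; split => j /=.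
  by move=> [ja /negP]; rewrite -ltNge ja andbT.
by move=> /andP[bj ->]; split => //; apply/negP; rewrite -ltNge.
Unshelve. all: by end_near. Qed.

(** The event that the supremum is at most [x] is squeezed between two events
    on the increment of [N], to which [cvg_poisson_itv] applies. In the upper one
    the lower end point is decreased by 1, as [cvg_poisson_itv] is about
    intervals open on the left; this moves it by [o(sqrt mu)]. *)
Lemma cvg_cdf_sup_error (R : realType)
    (d : measure_display) (T : measurableType d) (P : probability T R)
    (N : R -> {RV P >-> nat}) (m tau_star x : R) (tau : R^nat) :
  (forall w (s t : R), 0 <= s -> s <= t -> (N s w <= N t w)%N) ->
  (forall t : R, tau_star <= t ->
    pushforward P (increment N tau_star t) = poisson_prob (m * (t - tau_star)) 0) ->
  0 < tau_star -> 0 < m -> 0 <= x ->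
  tau n @[n --> \oo] --> +oo ->
  cdf (sup_error N m tau_star (tau n) : {RV P >-> R}) x @[n --> \oo] -->
  normal_prob 0 1 `](- (x * expR 1 * Num.sqrt m)), (x * expR 1 * Num.sqrt m)].
Proof.
move=> Nle Npois ts0 m0 x0 tauoo; set c := x * expR 1 * Num.sqrt m.
(* [v n] is defined by [sqrt (tau n) * (v n * exp (- 1)) = x]. *)
pose v n := x * expR 1 / Num.sqrt (tau n).
pose mu n := m * (tau n - tau_star).
have Npre t (B : set nat) : tau_star <= t ->
    P [set w | B (increment N tau_star t w)] = poisson_prob (m * (t - tau_star)) 0 B.
  by move=> tst; rewrite -Npois.
have tauV : (tau n)^-1 @[n --> \oo] --> (0 : R) by exact: cvg_invy.
have v0 : v n @[n --> \oo] --> (0 : R).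
  rewrite -(mulr0 (x * expR 1)); apply: cvgMl_tmp.
  by apply: cvg_invy; exact: cvgy_sqrt.
have muoo : mu n @[n --> \oo] --> (+oo : set_system R).
  apply/cvgryPge => A; near=> n.
  rewrite /mu -ler_pdivrMl// lerBrDr; near: n.
  by move/cvgryPge : tauoo; apply.
have smu0 : (Num.sqrt (mu n))^-1 @[n --> \oo] --> (0 : R).
  by apply: cvg_invy; exact: cvgy_sqrt.
(* As [tau_star / tau n] tends to 0, [mu n] is equivalent to [m * tau n]. *)
have gc : Num.sqrt (mu n) * v n @[n --> \oo] --> c.
  have : x * expR 1 * Num.sqrt (m * (1 - tau_star / tau n)) @[n --> \oo] --> c.
    apply: cvgMl_tmp.
    have tt : m * (1 - tau_star / tau n) @[n --> \oo] --> m.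
      rewrite -[X in _ --> X]mulr1; apply: cvgMl_tmp.
      rewrite -[X in _ --> X]subr0; apply: cvgB; first exact: cvg_cst.
      by rewrite -(mulr0 tau_star); exact: cvgMl_tmp.
    by apply: (cvg_comp _ Num.sqrt tt); exact: sqrt_continuous.
  apply: cvg_trans; apply: near_eq_cvg; near=> n.
  have tau0 : 0 < tau n by near: n; move/cvgryPgt : tauoo; apply.
  rewrite /v mulrCA; congr (_ * _).
  rewrite -sqrtrV ?(ltW tau0)// -sqrtrM; last first.
    near: n; move/cvgryPge : muoo; apply.
  by congr Num.sqrt; rewrite /mu; field; rewrite gt_eqF.
have v_ge0 n : 0 <= v n by rewrite divr_ge0 ?sqrtr_ge0// mulr_ge0 ?expR_ge0.
have tau_gt : \forall n \near \oo, tau_star < tau n.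
  by near=> n; near: n; move/cvgryPgt : tauoo; apply.
have mu_gt0 : \forall n \near \oo, 0 < mu n.
  by near=> n; near: n; move/cvgryPgt : muoo; apply.
have v_lt1 : \forall n \near \oo, v n < 1 by apply: (cvgr_lt _ v0).
have vx : \forall n \near \oo, Num.sqrt (tau n) * (v n * expR (-1)) = x.
  near=> n.
  have t0 : 0 < Num.sqrt (tau n).
    by rewrite sqrtr_gt0 (lt_trans ts0)//; near: n.
  rewrite /v expRN; field.
  by rewrite !gt_eqF ?expR_gt0.
have mhatE n w : tau_star < tau n ->
    m_hat N tau_star (tau n) w = (increment N tau_star (tau n) w)%:R / (tau n - tau_star).
  by move=> tt; rewrite /m_hat /increment natrB// Nle// ltW.
(* The probabilities of the two events on the increment that squeeze the event
   on the supremum. *)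
pose lo n := poisson_prob (mu n) 0 [set j | mu n / (1 + v n) < j%:R <= mu n * (1 + v n)].
pose up n := poisson_prob (mu n) 0 [set j | mu n * (1 - v n) - 1 < j%:R <= mu n / (1 - v n)].
have cN : - c <= c.
  by rewrite ge0_cp// !mulr_ge0 ?expR_ge0 ?sqrtr_ge0.
have sqE : \forall n \near \oo, 0 < Num.sqrt (mu n) /\ mu n = Num.sqrt (mu n) ^+ 2.
  near=> n; have mu0 : 0 < mu n by near: n.
  by rewrite sqrtr_gt0 mu0 sqr_sqrtr// ltW.
have Dv1 : (1 + v n)^-1 @[n --> \oo] --> (1 : R).
  rewrite -[X in _ --> X]invr1; apply: cvgV; first exact: oner_neq0.
  by rewrite -[X in _ --> X]addr0; apply: cvgD => //; exact: cvg_cst.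
have Bv1 : (1 - v n)^-1 @[n --> \oo] --> (1 : R).
  rewrite -[X in _ --> X]invr1; apply: cvgV; first exact: oner_neq0.
  by rewrite -[X in _ --> X]subr0; apply: cvgB => //; exact: cvg_cst.
have loc : lo n @[n --> \oo] --> normal_prob 0 1 `]- c, c].
  apply: cvg_poisson_itv => //.
  - apply: cvg_trans gc; apply: near_eq_cvg; near=> n.
    have [r0 ->] : 0 < Num.sqrt (mu n) /\ mu n = Num.sqrt (mu n) ^+ 2 by near: n.
    by rewrite sqrtr_sqr gtr0_norm//; field; rewrite gt_eqF.
  - have : - (Num.sqrt (mu n) * v n) * (1 + v n)^-1 @[n --> \oo] --> - c.
      by rewrite -[X in _ --> X]mulr1; apply: cvgM => //; exact: cvgN.
    apply: cvg_trans; apply: near_eq_cvg; near=> n.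
    have [r0 ->] : 0 < Num.sqrt (mu n) /\ mu n = Num.sqrt (mu n) ^+ 2 by near: n.
    have v1 : 0 < 1 + v n by rewrite ltr_pwDl.
    by rewrite sqrtr_sqr gtr0_norm//; field; rewrite !gt_eqF.
  - near=> n.
    have mu0 : 0 < mu n by near: n.
    have v1 : 1 <= 1 + v n by rewrite lerDl.
    rewrite ler_pM2l// (@le_trans _ _ 1)// invf_le1// (lt_le_trans ltr01)//.
have upc : up n @[n --> \oo] --> normal_prob 0 1 `]- c, c].
  apply: cvg_poisson_itv => //.
  - have : Num.sqrt (mu n) * v n * (1 - v n)^-1 @[n --> \oo] --> c.
      by rewrite -[X in _ --> X]mulr1; apply: cvgM.
    apply: cvg_trans; apply: near_eq_cvg; near=> n.
    have [r0 ->] : 0 < Num.sqrt (mu n) /\ mu n = Num.sqrt (mu n) ^+ 2 by near: n.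
    have v1 : 0 < 1 - v n by rewrite subr_gt0; near: n.
    by rewrite sqrtr_sqr gtr0_norm//; field; rewrite !gt_eqF.
  - have : - (Num.sqrt (mu n) * v n) - (Num.sqrt (mu n))^-1 @[n --> \oo] --> - c.
      by rewrite -[X in _ --> X]subr0; apply: cvgB => //; exact: cvgN.
    apply: cvg_trans; apply: near_eq_cvg; near=> n.
    have [r0 ->] : 0 < Num.sqrt (mu n) /\ mu n = Num.sqrt (mu n) ^+ 2 by near: n.
    by rewrite sqrtr_sqr gtr0_norm//; field; rewrite !gt_eqF.
  - near=> n.
    have mu0 : 0 < mu n by near: n.
    have v1 : 0 < 1 - v n by rewrite subr_gt0; near: n.
    rewrite (@le_trans _ _ (mu n))//.
      by rewrite lerBlDr ler_wpDr// ler_piMr ?(ltW mu0)// gerBl.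
    by rewrite ler_pMr// invf_ge1// gerBl.
apply: (squeeze_cvge _ loc upc); near=> n.
have tn : tau_star < tau n by near: n.
have s0 : 0 < tau n - tau_star by rewrite subr_gt0.
have vn1 : v n < 1 by near: n.
have vxn : Num.sqrt (tau n) * (v n * expR (-1)) = x by near: n.
rewrite /lo /up /mu -!Npre ?(ltW tn)// /cdf /distribution /pushforward.
have minc (B : set nat) :
    measurable [set w | B (increment N tau_star (tau n) w)].
  rewrite -[X in measurable X]setTI.
  have : measurable_fun setT (increment N tau_star (tau n)).
    by apply: measurable_fun_subn.
  by apply.
have msup : measurable (sup_error N m tau_star (tau n) @^-1` `]-oo, x]).
  by rewrite -[X in measurable X]setTI; exact: measurable_sup_error.
have Nw w : (N tau_star w <= N (tau n) w)%N by rewrite Nle// ltW.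
apply/andP; split; apply: le_measure; rewrite ?inE// => w /=; rewrite in_itv/=.
- move=> /andP[/ltW lw wu]; rewrite -vxn; apply: sup_error_le => //.
  rewrite mhatE// ler_pdivlMr// ler_pdivrMr//.
  by rewrite mulrAC lw mulrAC.
- rewrite -{1}vxn => /(sup_error_le_inv _ _ _ _ _ m0 ts0 tn (Nw w) _ vn1).
  rewrite mhatE// ler_pdivlMr// ler_pdivrMr// => /andP[lw wu].
  by rewrite ltrBlDr [X in _ <= X]mulrAC wu andbT mulrAC (le_lt_trans lw)// ltrDl.
Unshelve. all: by end_near. Qed.

Theorem theorem5p2 (R : realType)
    (d : measure_display) (T : measurableType d) (P : probability T R)
    (N : R -> {RV P >-> nat}) (lambda : R -> R) (tau_star m : R)
    (d' : measure_display) (T' : measurableType d') (P' : probability T' R)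
    (Z : {RV P' >-> R})
    (lambda_continuous : {within `[0, +oo[, continuous lambda})
    (lambda_ge0 : forall t : R, 0 <= t -> 0 <= lambda t)
    (N_poisson : nonhomogeneous_poisson_process N lambda)
    (tau_star_gt0 : 0 < tau_star) (m_gt0 : 0 < m)
    (lambda_const : forall t : R, tau_star <= t -> lambda t = m)
    (Z_normal : distribution P' Z = normal_prob 0 (Num.sqrt (expR (-2) / m))) :
  cvg_in_distribution +oo
    (fun tau => sup_error N m tau_star tau : {RV P >-> R})
    (abs_rv Z : {RV P' >-> R}).
Proof.
set sigma := Num.sqrt _ in Z_normal.
move=> x _; apply/cvge_pinftyP => tau tauoo.
have N_le w (s t : R) : 0 <= s -> s <= t -> (N s w <= N t w)%N.
  exact: (nhpp_nondecreasing N_poisson).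
(* For [x < 0] both distribution functions are eventually 0 at [x], as the two
   variables are nonnegative. *)
have [x0|x0] := ltP x 0.
  have -> : cdf (abs_rv Z : {RV P' >-> R}) x = 0%E.
    rewrite /cdf /distribution /pushforward (_ : _ @^-1` _ = set0) ?measure0//.
    apply/seteqP; split => w //=; rewrite in_itv/= /abs_rv => Zx.
    by have := le_lt_trans Zx x0; rewrite normr_lt0.
  apply: (@cvg_trans _ ((fun=> 0%E) n @[n --> \oo])); last exact: cvg_cst.
  apply: near_eq_cvg; near=> n.
  rewrite /cdf /distribution /pushforward (_ : _ @^-1` _ = set0) ?measure0//.
  have tn : tau_star < tau n by near: n; move/cvgryPgt : tauoo; apply.
  apply/seteqP; split => w //=; rewrite in_itv/= leNgt (lt_le_trans x0)//.
  by apply: sup_error_ge0 => //; rewrite N_le// ltW.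
have sigma0 : 0 < sigma by rewrite sqrtr_gt0 divr_gt0 ?expR_gt0.
have cE : x / sigma = x * expR 1 * Num.sqrt m.
  rewrite -mulrA; congr (_ * _).
  rewrite /sigma -sqrtrV ?divr_ge0 ?expR_ge0 ?(ltW m_gt0)// invf_div -expRN opprK mulrC.
  rewrite sqrtrM ?expR_ge0// (_ : 2 = 1 + 1 :> R)// expRD -expr2 sqrtr_sqr.
  by rewrite ger0_norm ?expR_ge0.
have -> : cdf (abs_rv Z : {RV P' >-> R}) x =
    normal_prob 0 1 `](- (x * expR 1 * Num.sqrt m)), (x * expR 1 * Num.sqrt m)].
  rewrite [RHS]integral_itv_obnd_cbnd; last first.
    by apply/measurable_EFinP/measurable_funTS; exact: measurable_normal_pdf.
  rewrite -cE -[RHS]normal_prob_scale// -Z_normal.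
  rewrite /cdf /distribution /pushforward; congr (P' _).
  by apply/seteqP; split => w /=; rewrite !in_itv/= /abs_rv ler_norml.
apply: cvg_cdf_sup_error => // t st.
rewrite (nhpp_poisson N_poisson) ?(ltW tau_star_gt0)//.
by rewrite (cumulative_intensity_cst _ m)// ltW.
Unshelve. all: by end_near. Qed.
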